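(* Let $r\ge\beta_1(1)+1$ and fix a mesh $\Delta=(\Delta x,\Delta t)$ as described in the context. Then for each $c\in[c_0,c_1]$ there exists a fixed point $\bar u^0_\Delta\in L^\infty_{r,0}(\mathbb T)$ of $\phi^1_\Delta(\cdot;c)$, which yields a time periodic difference solution $\phi^t_\Delta(\bar u^0_\Delta;c)$ (of period one in $t$). Such a periodic solution is unique with respect to $c$. Any other solution $\phi^t_\Delta(u^0;c)$, $u^0\in L^\infty_{r,0}(\mathbb T)$, exponentially falls into the periodic state; namely, there exist $\rho\in(0,1)$ and $a>0$ depending on $\Delta$, but independent of $u^0$, such that $$\|\phi^t_\Delta(u^0;c)-\phi^t_\Delta(\bar u^0_\Delta;c)\|_{L^\infty}\le a\rho^t\quad\text{for all }t\in\mathbb N.$$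
   Context: $\mathbb T=\mathbb R/\mathbb Z$. The flux $H=H(x,t,p):\mathbb T^2\times\mathbb R\to\mathbb R$ satisfies: (A1) $H$ is $C^2$; (A2) $H_{pp}>0$; (A3) $\lim_{|p|\to\infty}H(x,t,p)/|p|=+\infty$; (A4) the Legendre transform $L(x,t,\xi)=\sup_{p}\{\xi p-H(x,t,p)\}$ satisfies $|L_x|\le\alpha(|L|+1)$ for some $\alpha>0$. Real numbers $r>0$, $c_0\le c_1$ are fixed. $L^\infty_{r,0}(\mathbb T)$ is the set of $u^0\in L^\infty(\mathbb T)$ with $\|u^0\|_{L^\infty}\le r$ and $\int_{\mathbb T}u^0\,dx=0$. $\phi^t(u^0;c)=u(\cdot,t)$, where $u$ is the entropy solution of $u_t+H(x,t,c+u)_x=0$ with $u(\cdot,0)=u^0$. Mesh: $N\le K$ are natural numbers, $\Delta x=(2N)^{-1}$, $\Delta t=(2K)^{-1}$, $\lambda=\Delta t/\Delta x$, $x_m=m\Delta x$, $t_k=k\Delta t$. Lax-Friedrichs scheme: $u^k_m$ ($m+k$ even) satisfies $$\frac{u^{k+1}_{m+1}-\frac{u^k_m+u^k_{m+2}}2}{\Delta t}+\frac{H(x_{m+2},t_k,c+u^k_{m+2})-H(x_m,t_k,c+u^k_m)}{2\Delta x}=0,\quad u^k_{m\pm2N}=u^k_m,$$ with $u^0_m=\frac1{2\Delta x}\int_{x_m-\Delta x}^{x_m+\Delta x}u^0(y)\,dy$ for $m$ even. Set $u_\Delta(x,t)=u^k_m$ for $(x,t)\in[x_{m-1},x_{m+1})\times[t_k,t_{k+1})$,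 $m+k$ even, and $\phi^t_\Delta(u^0;c)=u_\Delta(\cdot,t)$. Choice of $r$ and mesh: $\beta_1(1)>0$ is a constant, independent of $r$, $c\in[c_0,c_1]$ and the initial data, such that $\|\phi^1(u^0;c)\|_{L^\infty}\le\beta_1(1)$ for all $c\in[c_0,c_1]$ and all bounded zero-mean $u^0$. Constants $0<\lambda_0<\lambda_1$ and $\delta>0$ are fixed such that, for every mesh with $\lambda_0\le\lambda<\lambda_1$ and $\Delta x\le\delta$, every $c\in[c_0,c_1]$ and every $u^0\in L^\infty_{r,0}(\mathbb T)$: (i) the difference solution satisfies the CFL condition $|H_p(x_m,t_k,c+u^k_m)|\le\lambda_1^{-1}<\lambda^{-1}$ for all $k\ge0$ and all $m$ with $m+k$ even; (ii) $\|\phi^1_\Delta(u^0;c)\|_{L^\infty}\le\beta_1(1)+1$, so $\phi^1_\Delta(\cdot;c)$ maps $L^\infty_{r,0}(\mathbb T)$ into itself. (Such constants exist by the paper's stability theory.) The fixed mesh $\Delta$ satisfies $\lambda_0\le\lambda<\lambda_1$ and $\Delta x\le\delta$. *)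

(* Defs.v *)
From mathcomp Require Import all_boot all_order all_algebra.
From mathcomp Require Import all_classical all_reals all_analysis.
From mathcomp Require Import ring lra zify.
Set Implicit Arguments.
Unset Strict Implicit.
Unset Printing Implicit Defensive.
Import Order.TTheory GRing.Theory Num.Theory.
Import numFieldNormedType.Exports.
Local Open Scope classical_set_scope.
Local Open Scope ring_scope.

Section Calculus.
Context {R : realType}.

(* C^k regularity through iterated directional derivatives; for a
   finite-dimensional V this is the usual class C^k. *)
Fixpoint Ck (V : normedModType R) (k : nat) (f : V -> R^o) : Prop :=
  continuous f /\
  match k with
  | 0 => True
  | k'.+1 => forall v : V, (forall x, derivable f x v) /\ Ck k' ('D_v f)
  end.

Definition smooth (V : normedModType R) (f : V -> R^o) : Prop :=
  forall k, Ck k f.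

(* Functions on the torus are represented by 1-periodic functions on R. *)
Definition periodic1 (f : R -> R) : Prop := forall x, f (x + 1) = f x.

End Calculus.

Section Flux.
Context {R : realType}.
Implicit Type H : R -> R -> R -> R.

Definition flux_x H (x t p : R) : R := (H ^~ t ^~ p)^`()%classic x.
Definition flux_p H (x t p : R) : R := (H x t)^`()%classic p.
Definition flux_pp H (x t p : R) : R := (flux_p H x t)^`()%classic p.

Definition legendre H (x t xi : R) : R := sup [set xi * p - H x t p | p in setT].
Definition legendre_x H (x t xi : R) : R := (legendre H ^~ t ^~ xi)^`()%classic x.

Record flux_conditions H : Prop := {
  flux_periodic_x : forall t p, periodic1 (H ^~ t ^~ p) ;
  flux_periodic_t : forall x p, periodic1 (H x ^~ p) ;
  flux_C2 : Ck 2 (fun z : R^o * R^o * R^o => H z.1.1 z.1.2 z.2) ;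
  flux_convex : forall x t p, 0 < flux_pp H x t p ;
  flux_superlinear : forall x t,
    (H x t p / `|p| @[p --> +oo] --> +oo) /\
    (H x t p / `|p| @[p --> -oo] --> +oo) ;
  flux_legendre : exists2 alpha : R, 0 < alpha &
    forall x t xi,
      `|legendre_x H x t xi| <= alpha * (`|legendre H x t xi| + 1) }.

End Flux.

Section LebesgueSpace.
Context {R : realType}.
Let mu := @lebesgue_measure R.

(* For a 1-periodic u the essential supremum over R is the one over the torus. *)
Definition Linf_norm (u : R -> R) : \bar R := 'N[mu]_+oo[EFin \o u]%E.

Definition Linf_zero_mean (r : R) (u : R -> R) : Prop :=
  [/\ measurable_fun setT u, periodic1 u, (Linf_norm u <= r%:E)%E
    & \int[mu]_(x in `[0, 1]) u x = 0].

End LebesgueSpace.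

Section EntropySolution.
Context {R : realType}.
Let mu := @lebesgue_measure R.

Definition test_function (phi : R -> R -> R) : Prop :=
  [/\ smooth (fun z : R^o * R^o => phi z.1 z.2),
      forall t, periodic1 (phi ^~ t),
      forall x t, 0 <= phi x t
    & exists a b : R, 0 < a /\
        forall x t, ~~ (a <= t <= b) -> phi x t = 0].

Definition entropy_integrand (H : R -> R -> R -> R) (c : R)
    (u phi : R -> R -> R) (k x t : R) : R :=
  `|u x t - k| * (phi x)^`()%classic t
  + Num.sg (u x t - k) *
      ((H x t (c + u x t) - H x t (c + k)) * (phi ^~ t)^`()%classic x
       - flux_x H x t (c + k) * phi x t).

(* Kruzhkov's entropy solution of u_t + H(x, t, c + u)_x = 0 on the torus, taken
   in C([0, +oo); L^1) so that the trace u(., t) makes sense for every t >= 0. *)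
Record entropy_solution (H : R -> R -> R -> R) (c : R) (u0 : R -> R)
    (u : R -> R -> R) : Prop := {
  entropy_periodic : forall t : R, 0 <= t -> periodic1 (u ^~ t) ;
  entropy_measurable :
    measurable_fun [set z : R * R | 0 <= z.2] (fun z : R * R => u z.1 z.2) ;
  entropy_bounded : forall T : R, exists M : R, forall t : R, 0 <= t <= T ->
    (Linf_norm (u ^~ t) <= M%:E)%E ;
  entropy_continuous : forall t : R, 0 <= t ->
    \int[mu]_(x in `[0, 1]) `|u x s - u x t|
      @[s --> within `[0, +oo[ (nbhs t)] --> (0 : R) ;
  entropy_initial : {ae mu, forall x, u x 0 = u0 x} ;
  entropy_inequality : forall (k : R) (phi : R -> R -> R), test_function phi ->
    0 <= \int[(mu \x mu)%E]_(z in `[0, 1] `*` `[0, +oo[)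
           entropy_integrand H c u phi k z.1 z.2 }.

End EntropySolution.

Section LaxFriedrichs.
Context {R : realType}.
Let mu := @lebesgue_measure R.
Variables (H : R -> R -> R -> R) (c : R) (N K : nat) (u0 : R -> R).

Definition mesh_dx : R := (2 * N)%N%:R^-1.
Definition mesh_dt : R := (2 * K)%N%:R^-1.
Definition mesh_lambda : R := mesh_dt / mesh_dx.
Definition mesh_x (m : int) : R := m%:~R * mesh_dx.
Definition mesh_t (k : nat) : R := k%:R * mesh_dt.

Definition on_grid (m : int) (k : nat) : bool := (2 %| m + k%:Z)%Z.

(* The scheme solved for the new value.  The recursion also produces values off
   the staggered grid; the two parity classes do not interact. *)
Fixpoint LF (k : nat) (m : int) : R :=
  if k is k'.+1 then
    (LF k' (m - 1) + LF k' (m + 1)) / 2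
    - mesh_dt / (2 * mesh_dx) *
      (H (mesh_x (m + 1)) (mesh_t k') (c + LF k' (m + 1))
       - H (mesh_x (m - 1)) (mesh_t k') (c + LF k' (m - 1)))
  else
    (2 * mesh_dx)^-1 *
    \int[mu]_(y in `[mesh_x m - mesh_dx, mesh_x m + mesh_dx]) u0 y.

(* The m with m + k even and x in [x_{m-1}, x_{m+1}). *)
Definition cell_x (k : nat) (x : R) : int :=
  let j := Num.floor (x / mesh_dx) in if on_grid j k then j else j + 1.

Definition cell_t (t : R) : nat := Num.truncn (t / mesh_dt).

Definition u_Delta (x t : R) : R := LF (cell_t t) (cell_x (cell_t t) x).

Lemma LF_scheme k m : (0 < N)%N -> (0 < K)%N ->
  (LF k.+1 (m + 1) - (LF k m + LF k (m + 2)) / 2) / mesh_dt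
  + (H (mesh_x (m + 2)) (mesh_t k) (c + LF k (m + 2))
     - H (mesh_x m) (mesh_t k) (c + LF k m)) / (2 * mesh_dx) = 0.
Proof.
move=> N0 K0.
have dx0 : mesh_dx != 0 by rewrite invr_eq0 pnatr_eq0; lia.
have dt0 : mesh_dt != 0 by rewrite invr_eq0 pnatr_eq0; lia.
have -> : LF k.+1 (m + 1) = (LF k m + LF k (m + 2)) / 2
    - mesh_dt / (2 * mesh_dx) *
      (H (mesh_x (m + 2)) (mesh_t k) (c + LF k (m + 2))
       - H (mesh_x m) (mesh_t k) (c + LF k m)).
  rewrite /=; have -> : m + 1 - 1 = m by lia.
  by have -> : m + 1 + 1 = m + 2 by lia.
field.
by rewrite dx0 dt0.
Qed.

Lemma u_DeltaE m k x t : (0 < N)%N -> (0 < K)%N -> on_grid m k ->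
  mesh_x (m - 1) <= x < mesh_x (m + 1) -> mesh_t k <= t < mesh_t k.+1 ->
  u_Delta x t = LF k m.
Proof.
move=> N0 K0 mk xm tk.
have dx0 : 0 < mesh_dx by rewrite invr_gt0 ltr0n; lia.
have dt0 : 0 < mesh_dt by rewrite invr_gt0 ltr0n; lia.
have -> : u_Delta x t = LF k (cell_x k x).
  rewrite /u_Delta /cell_t (@truncn_def _ _ k)//.
  by rewrite ler_pdivlMr// ltr_pdivrMr.
congr LF; rewrite /cell_x.
have := floor_itv (x / mesh_dx); set j := Num.floor _ => /andP[j1 j2].
move: xm; rewrite /mesh_x -ler_pdivlMr// -ltr_pdivrMr// => /andP[m1 m2].
have : ((m - 1)%:~R : R) < (j + 1)%:~R by exact: le_lt_trans j2.
have : (j%:~R : R) < (m + 1)%:~R by exact: le_lt_trans m2.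
rewrite !ltr_int /on_grid; move: mk; rewrite /on_grid => mk jm mj.
case: ifPn => jk; lia.
Qed.

End LaxFriedrichs.

Definition phi_Delta {R : realType} (H : R -> R -> R -> R) (N K : nat)
    (t c : R) (u0 : R -> R) : R -> R := fun x => u_Delta H c N K u0 x t.

Definition mesh_ok {R : realType} (lambda0 lambda1 delta : R) (N K : nat) : Prop :=
  [/\ (0 < N)%N, (N <= K)%N,
      lambda0 <= mesh_lambda N K, mesh_lambda N K < lambda1
    & mesh_dx N <= delta].

Definition CFL {R : realType} (H : R -> R -> R -> R) (lambda1 c : R) (N K : nat)
    (u0 : R -> R) : Prop :=
  lambda1^-1 < (mesh_lambda N K)^-1 /\
  forall (k : nat) (m : int), on_grid m k ->
    `|flux_p H (mesh_x N m) (mesh_t K k) (c + LF H c N K u0 k m)| <= lambda1^-1.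

(* Main.v *)
Require Import Defs.
From mathcomp Require Import all_boot all_order all_algebra.
From mathcomp Require Import all_classical all_reals all_analysis.
From mathcomp Require Import measurable_realfun ess_sup_inf.
From mathcomp Require Import ring lra zify.
Set Implicit Arguments.
Unset Strict Implicit.
Unset Printing Implicit Defensive.
Import Order.TTheory GRing.Theory Num.Theory.
Import numFieldNormedType.Exports.
Local Open Scope classical_set_scope.
Local Open Scope ring_scope.

(** The update of the scheme reads u^(k+1)_(m+1) = a_m(u_m) + b_(m+2)(u_(m+2)),
    where a_m(u) = u/2 + (lambda/2) H(x_m, t_k, c + u) and a_m + b_m is the
    identity.  Hence the difference of two solutions obeys a linear recursion
    d^(k+1)_(m+1) = alpha_m d_m + (1 - alpha_(m+2)) d_(m+2), where alpha_m is
    (1 + lambda s)/2 for the slope s of a chord of H in p.  By the mean value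
    theorem and the monotonicity of H_p, s lies between the values of H_p at
    the two solutions, so the CFL condition puts alpha_m in [eps, 1 - eps]
    with eps = (1 - lambda/lambda1)/2 > 0 ([flux_slope_bound],
    [weight_bounds]).

    Each weight splits the mass of one node among two neighbours, so after n
    steps every node receives at least the fraction eps^n of the mass of each
    of n + 1 consecutive nodes.  A time period has 2K >= N steps and a space
    period has N nodes of a given parity, so every node then receives
    something from every node.  This is Doeblin's minorization: the positive
    and the negative part of a difference of mean zero have equal mass and
    overlap after one period, and the cancellation contracts the l^1 norm by
    the factor 1 - eps^(2K) ([evolve_contraction], [LF_contraction]).

    The rest is Banach's fixed point argument for the map of period one.  It
    acts on the finite vector of cell averages, because the time periodicity
    of H makes the scheme started from u_Delta(., 1) continue the original one
    ([LF_restart]), and the bound assumed on phi^1_Delta keeps the iterates in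
    L^infty_(r,0), where the CFL condition holds ([phi1_data]).  The
    iterates of 0 converge geometrically; their limit, spread over the cells,
    is the fixed point ([exists_fixed]).  Contraction also gives its uniqueness
    ([LF_fixed_unique]) and the exponential decay ([LF_decay]). *)

(** * Transport of mass with periodic weights *)

Section Transport.
Context {R : realType}.
Implicit Types (f g a : int -> R) (alpha : nat -> int -> R) (N n : nat).

Definition grid_periodic N f : Prop := forall i, f (i + N%:Z) = f i.

Definition period_sum N f : R := \sum_(i < N) f i%:Z.

Lemma period_sum_shift1 N f : grid_periodic N f ->
  period_sum N (fun i => f (i + 1)) = period_sum N f.
Proof.
case: N => [|N] fN; first by rewrite /period_sum !big_ord0.
rewrite /period_sum big_ord_recr [RHS]big_ord_recl /= addrC; congr (_ + _).
  by rewrite -(fN 0); congr f; lia.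
by apply: eq_bigr => i _; congr f; rewrite /bump; lia.
Qed.

Lemma period_sum_shift N f (z : int) : grid_periodic N f ->
  period_sum N (fun i => f (i + z)) = period_sum N f.
Proof.
move=> fN; elim: z => [|n IH|n IH].
- by apply: eq_bigr => i _; rewrite addr0.
- rewrite -IH -[RHS]period_sum_shift1; last first.
    by move=> i; rewrite addrAC fN.
  by apply: eq_bigr => i _; congr f; lia.
- rewrite -IH -[LHS]period_sum_shift1; last first.
    by move=> i; rewrite addrAC fN.
  by apply: eq_bigr => i _; congr f; lia.
Qed.

Lemma le_period_sum N f (z : int) : grid_periodic N f -> (0 < N)%N ->
  (forall i, 0 <= f i) -> f z <= period_sum N f.
Proof.
move=> fN N0 f0; rewrite -(period_sum_shift z fN) /period_sum.
case: N fN N0 => // N fN _; rewrite big_ord_recl /= add0r lerDl.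
by apply: sumr_ge0 => i _; exact: f0.
Qed.

(** One step for the difference of two solutions, in the coordinate i given by
    m = 2 i + k: the node at i keeps the share [a i] of its content and sends
    the rest to i - 1. *)
Definition transport a f (i : int) : R :=
  a i * f i + (1 - a (i + 1)) * f (i + 1).

Fixpoint evolve alpha n f : int -> R :=
  if n is n'.+1 then transport (alpha n') (evolve alpha n' f) else f.

Variables (N : nat) (eps : R) (alpha : nat -> int -> R).
Hypothesis eps_ge0 : 0 <= eps.
Hypothesis alpha_per : forall n, grid_periodic N (alpha n).
Hypothesis alpha_bounds : forall n i, eps <= alpha n i <= 1 - eps.

Lemma evolveB n f g i :
  evolve alpha n (fun j => f j - g j) i = evolve alpha n f i - evolve alpha n g i.
Proof. by elim: n i => //= n IH i; rewrite /transport !IH; ring. Qed.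

Lemma evolve_periodic n f : grid_periodic N f ->
  grid_periodic N (evolve alpha n f).
Proof.
move=> fN; elim: n => //= n IH i.
by rewrite /transport alpha_per IH addrAC alpha_per IH.
Qed.

(** What a node does not keep goes to its neighbour, so mass is conserved. *)
Lemma evolve_sum n f : grid_periodic N f ->
  period_sum N (evolve alpha n f) = period_sum N f.
Proof.
move=> fN; elim: n => //= n IH; rewrite -IH /period_sum /transport big_split /=.
have := @period_sum_shift1 N (fun i => (1 - alpha n i) * evolve alpha n f i).
rewrite /period_sum => -> => [|i]; last by rewrite alpha_per evolve_periodic.
by rewrite -big_split /=; apply: eq_bigr => i _; ring.
Qed.

(** Among the paths from i + j to i there is one of n steps, each carrying a
    share of at least eps. *)
Lemma evolve_ge n f i j : (forall l, 0 <= f l) -> (j <= n)%N ->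
  eps ^+ n * f (i + j%:Z) <= evolve alpha n f i.
Proof.
move=> f0; elim: n i j => [|n IH] i j jn /=.
  by move: jn; rewrite leqn0 => /eqP ->; rewrite addr0 expr0 mul1r.
have en : 0 <= eps ^+ n by rewrite exprn_ge0.
have pos l : 0 <= evolve alpha n f l.
  by apply: le_trans (IH l 0%N isT); rewrite mulr_ge0.
have /andP[a1 a2] := alpha_bounds n i.
have /andP[b1 b2] := alpha_bounds n (i + 1).
have b0 : eps <= 1 - alpha n (i + 1) by lra.
have nnl : 0 <= alpha n i * evolve alpha n f i.
  by rewrite mulr_ge0// (le_trans eps_ge0).
have nnr : 0 <= (1 - alpha n (i + 1)) * evolve alpha n f (i + 1).
  by rewrite mulr_ge0// (le_trans eps_ge0).
rewrite /transport exprS -mulrA; case: j jn => [|j] jn.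
  apply: le_trans (_ : alpha n i * evolve alpha n f i <= _); last by rewrite lerDl.
  by apply: ler_pM => //; rewrite ?mulr_ge0// IH.
apply: le_trans (_ : (1 - alpha n (i + 1)) * evolve alpha n f (i + 1) <= _).
  apply: ler_pM => //; rewrite ?mulr_ge0//.
  by rewrite (_ : i + j.+1%:Z = i + 1 + j%:Z) ?IH//; lia.
by rewrite lerDr.
Qed.

(** Doeblin's condition: once the number of steps reaches the period less one,
    every node is fed by all nodes. *)
Lemma evolve_minorization n f i : (N <= n.+1)%N -> grid_periodic N f ->
  (forall l, 0 <= f l) ->
  eps ^+ n * period_sum N f <= N%:R * evolve alpha n f i.
Proof.
move=> Nn fN f0; rewrite -(period_sum_shift i fN) mulr_sumr.
rewrite mulr_natl -[in leRHS](card_ord N) -sumr_const.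
apply: ler_sum => j _; rewrite addrC evolve_ge//.
by have := ltn_ord j; lia.
Qed.

(** The positive and the negative part p and q of [f] have the same mass S and
    evolve into functions that are both at least eta = eps^n S / N; the
    common part eta cancels in the difference, which removes 2 N eta from
    the norm 2 S. *)
Lemma evolve_contraction n f : (N <= n.+1)%N -> grid_periodic N f ->
  period_sum N f = 0 ->
  period_sum N (fun i => `|evolve alpha n f i|)
    <= (1 - eps ^+ n) * period_sum N (fun i => `|f i|).
Proof.
move=> Nn fN f_mean.
have [->|N0] := posnP N; first by rewrite /period_sum !big_ord0 mulr0.
have NR : (0 : R) < N%:R by rewrite ltr0n.
pose p i := Num.max (f i) 0; pose q i := Num.max (- f i) 0.
have pN : grid_periodic N p by move=> i; rewrite /p fN.
have qN : grid_periodic N q by move=> i; rewrite /q fN.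
have p0 i : 0 <= p i by rewrite le_max lexx orbT.
have q0 i : 0 <= q i by rewrite le_max lexx orbT.
have [fpq absf] : f = (fun i => p i - q i) /\ forall i, `|f i| = p i + q i.
  suff pq i : f i = p i - q i /\ `|f i| = p i + q i.
    by split=> [|i]; [apply/funext => i|]; case: (pq i).
  rewrite /p /q; case: (leP 0 (f i)) => fi.
    by rewrite max_r ?oppr_le0// ger0_norm// subr0 addr0.
  by rewrite max_l ?oppr_ge0 ?ltW// ltr0_norm// sub0r opprK add0r.
(* [f] occurs in the bodies of [p] and [q], where [fpq] must not rewrite it. *)
clearbody p q.
have sumpq : period_sum N p = period_sum N q.
  by apply/subr0_eq; rewrite -sumrB -[RHS]f_mean fpq.
set S := period_sum N p in sumpq.
pose eta := eps ^+ n * S / N%:R.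
have low g i : grid_periodic N g -> (forall l, 0 <= g l) -> period_sum N g = S ->
    eta <= evolve alpha n g i.
  move=> gN g0 gS; rewrite ler_pdivrMr// mulrC -gS mulrC [leRHS]mulrC.
  exact: evolve_minorization.
have -> : period_sum N (fun i => `|f i|) = S + S.
  rewrite {2}sumpq -big_split /=; apply: eq_bigr => i _; exact: absf.
have -> : (1 - eps ^+ n) * (S + S) =
    period_sum N (fun i => evolve alpha n p i + evolve alpha n q i - (eta + eta)).
  rewrite /period_sum sumrB big_split /= sumr_const card_ord.
  have -> : \sum_(i < N) evolve alpha n p i%:Z = S by exact: evolve_sum.
  have -> : \sum_(i < N) evolve alpha n q i%:Z = S.
    by rewrite [RHS]sumpq; exact: evolve_sum.
  rewrite -mulr_natl /eta; field; lra.
apply: ler_sum => i _.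
have -> : evolve alpha n f i = evolve alpha n p i - evolve alpha n q i.
  by rewrite fpq evolveB.
have := low p i pN p0 erefl; have := low q i qN q0 (esym sumpq).
set x := evolve _ _ p _; set y := evolve _ _ q _ => h1 h2.
by rewrite ler_norml; lra.
Qed.

End Transport.

(** * Chords of the flux in p *)

Section FluxSlope.
Context {R : realType}.
Variable H : R -> R -> R -> R.
Hypothesis fluxH : flux_conditions H.

(* The regularity of H is given in terms of directional derivatives of the
   uncurried map; the derivatives in p are those in the direction ep. *)
Let F : R^o * R^o * R^o -> R^o := fun z => H z.1.1 z.1.2 z.2.
Let ep : R^o * R^o * R^o := (0, 0, 1).

Let quotientE (G : R^o * R^o * R^o -> R^o) (x t p : R) :
  (fun h : R => h^-1 *: ((G \o shift (x, t, p)) (h *: ep) - G (x, t, p))) =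
  (fun h : R => h^-1 *: (((fun q : R => G (x, t, q)) \o shift p) (h *: 1)
                         - G (x, t, p))).
Proof.
apply/funext => h /=; congr (_ *: (G _ - _)).
by rewrite /ep; congr (_, _, _); rewrite /= ?scaler0 add0r.
Qed.

Let derivable_section (G : R^o * R^o * R^o -> R^o) x t p :
  derivable G (x, t, p) ep -> derivable (fun q : R => G (x, t, q) : R) p 1.
Proof. by rewrite /derivable quotientE. Qed.

Lemma derivable_flux x t p : derivable (H x t : R -> R) p 1.
Proof.
have [_ /(_ ep)[/(_ (x, t, p)) + _]] := flux_C2 fluxH.
exact: derivable_section.
Qed.

Let derive_section x t : (fun q : R => 'D_ep F (x, t, q) : R) = flux_p H x t.
Proof.
apply/funext => q; rewrite /flux_p derive1E /derive.
by rewrite quotientE.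
Qed.

Lemma derivable_flux_p x t p : derivable (flux_p H x t : R -> R) p 1.
Proof.
have [_ /(_ ep)[_ [_ /(_ ep)[/(_ (x, t, p)) + _]]]] := flux_C2 fluxH.
by move=> /derivable_section; rewrite -derive_section.
Qed.

Lemma flux_p_nondecreasing x t : {homo flux_p H x t : p q / p <= q}.
Proof.
move=> p q pq.
apply: (@ger0_derive1_le_cc _ (flux_p H x t) p q) => //.
- by move=> z _; exact: derivable_flux_p.
- by move=> z _; exact/ltW/(flux_convex fluxH).
- by apply: derivable_within_continuous => z _; exact: derivable_flux_p.
- by rewrite in_itv/= lexx.
- by rewrite in_itv/= lexx pq.
Qed.

(** The CFL condition bounds H_p at computed values only; by convexity H_p is
    monotone in p, which carries the bound to the points in between. *)
Lemma flux_mean_value x t p q : exists2 s,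
  flux_p H x t (Num.min p q) <= s <= flux_p H x t (Num.max p q)
  & H x t p - H x t q = s * (p - q).
Proof.
wlog qp : p q / q <= p => [wl|].
  have [qp|pq] := boolP (q <= p); first exact: wl.
  have [|s] := wl q p; first by rewrite ltW// ltNge.
  rewrite minC maxC => sb e; exists s => //.
  by rewrite -opprB e; ring.
have dH (y : R) : y \in `]q, p[ -> is_derive y (1 : R) (H x t) (flux_p H x t y).
  by move=> _; rewrite /flux_p derive1E; exact/derivableP/derivable_flux.
have cH : {within `[q, p], continuous H x t}.
  by apply: derivable_within_continuous => y _; exact: derivable_flux.
have [z] := MVT_segment qp dH cH.
rewrite in_itv/= => /andP[qz zp] e; exists (flux_p H x t z) => //.
by rewrite min_r// max_l// !flux_p_nondecreasing.
Qed.

(** At p = q the quotient is 0 / 0 = 0, which keeps [flux_slopeE] and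
    [flux_slope_bound] true without a case distinction. *)
Definition flux_slope x t p q : R := (H x t p - H x t q) / (p - q).

Lemma flux_slopeE x t p q : H x t p - H x t q = flux_slope x t p q * (p - q).
Proof.
rewrite /flux_slope; have [->|pq] := eqVneq p q; first by rewrite !subrr mulr0.
by rewrite divfK// subr_eq0.
Qed.

Lemma flux_slope_bound x t p q B :
  `|flux_p H x t p| <= B -> `|flux_p H x t q| <= B ->
  `|flux_slope x t p q| <= B.
Proof.
move=> pB qB; have [pq|pq] := eqVneq p q.
  by rewrite pq /flux_slope !subrr invr0 mulr0 normr0 (le_trans _ pB).
have [s sb e] := flux_mean_value x t p q.
have -> : flux_slope x t p q = s by rewrite /flux_slope e mulfK// subr_eq0.
move: sb pB qB; rewrite !ler_norml /Num.min /Num.max.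
by case: ifP => _; lra.
Qed.

End FluxSlope.

(** * Integrals of periodic functions *)

Section PeriodicIntegrals.
Context {R : realType}.
Local Notation mu := (@lebesgue_measure R).
Implicit Types (u : R -> R) (r a b c : R).

Lemma Linf_normP u r :
  (Linf_norm u <= r%:E)%E <-> {ae mu, forall x, `|u x| <= r}.
Proof.
have muT : (0 < mu setT)%E.
  by rewrite -set_itvNyy lebesgue_measure_itv /= ?ltNyy ?ltry.
rewrite /Linf_norm unlock muT; split => [/ess_supP|h].
  by apply: filterS => x /=; rewrite lee_fin.
apply/ess_supP; move: h.
by apply: (@filterS _ _ (ae_filter_ringOfSetsType mu)) => x /=; rewrite lee_fin.
Qed.

Lemma Linf_norm_le u r : (forall x, `|u x| <= r) -> (Linf_norm u <= r%:E)%E.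
Proof. by move=> ur; apply/Linf_normP; exact: aeW. Qed.

Lemma lebesgue_measure_cc a b : a <= b -> mu `[a, b] = (b - a)%:E.
Proof.
rewrite le_eqVlt => /orP[/eqP ->|ab]; first by rewrite set_itv1 lebesgue_measure_set1 subrr.
by rewrite lebesgue_measure_itv /= lte_fin ab.
Qed.

Lemma ae_bounded_integral_norm u r a b : 0 <= r -> a <= b ->
  measurable_fun setT u -> {ae mu, forall x, `|u x| <= r} ->
  (\int[mu]_(x in `[a, b]) `|(u x)%:E| <= (r * (b - a))%:E)%E.
Proof.
move=> r0 ab mu_u ur; rewrite EFinM -lebesgue_measure_cc//.
rewrite -integral_cst//; apply: ae_ge0_le_integral => //=.
- apply/measurable_EFinP; apply: measurableT_comp => //.
  exact: measurable_funTS.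
- move: ur; apply: (@filterS _ _ (ae_filter_ringOfSetsType mu)) => x /= ur _.
  by rewrite lee_fin.
Qed.

Lemma ae_bounded_integrable u r a b : 0 <= r -> a <= b ->
  measurable_fun setT u -> {ae mu, forall x, `|u x| <= r} ->
  mu.-integrable `[a, b] (EFin \o u).
Proof.
move=> r0 ab mu_u ur; apply/integrableP; split.
  by apply/measurable_EFinP; exact: measurable_funTS.
by apply: le_lt_trans (ae_bounded_integral_norm r0 ab mu_u ur) _; rewrite ltry.
Qed.

Lemma ae_bounded_Rintegral u r a b : 0 <= r -> a <= b ->
  measurable_fun setT u -> {ae mu, forall x, `|u x| <= r} ->
  `|\int[mu]_(x in `[a, b]) u x| <= r * (b - a).
Proof.
move=> r0 ab mu_u ur; have ui := ae_bounded_integrable r0 ab mu_u ur.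
apply: le_trans (le_normr_Rintegral _ ui) _ => //.
rewrite -lee_fin /Rintegral fineK; first exact: ae_bounded_integral_norm.
by apply: integrable_fin_num => //; exact: (integrable_norm ui).
Qed.

Lemma Rintegral_cc_split u a b c : a <= b -> b <= c ->
  mu.-integrable `[a, c] (EFin \o u) ->
  \int[mu]_(x in `[a, c]) u x =
  \int[mu]_(x in `[a, b]) u x + \int[mu]_(x in `[b, c]) u x.
Proof.
move=> ab bc ui.
rewrite -[X in _ + X]Rintegral_itv_obnd_cbnd; last first.
  apply: integrableS ui => // x /=; rewrite !in_itv/= => /andP[bx ->].
  by rewrite andbT (le_trans ab)// ltW.
by rewrite -(Rintegral_itvB ui) ?bnd_simp// addrC subrK.
Qed.

(** Lebesgue measure is translation invariant by its uniqueness on intervals;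
    the integral follows by pushing forward along the translation. *)
Lemma Rintegral_translate u a b c : measurable_fun setT u ->
  mu.-integrable `[a, b] (EFin \o (fun x => u (x + c))) ->
  \int[mu]_(x in `[a + c, b + c]) u x = \int[mu]_(x in `[a, b]) u (x + c).
Proof.
move=> mu_u ui.
pose T : measurableTypeR R -> measurableTypeR R := fun x => x + c.
have mT : measurable_fun setT T by exact: measurable_funD.
have preT (d e : bool) (x y : R) :
    T @^-1` [set` Interval (BSide d (x + c)) (BSide e (y + c))] =
    [set` Interval (BSide d x) (BSide e y)].
  by case: d; case: e; apply/seteqP; split => z;
    rewrite /T /= !in_itv/= ?lerD2r ?ltrD2r.
rewrite /Rintegral -(preT true false a b).
have := @integral_pushforward _ _ _ _ R T mT mu `[a + c, b + c]%classic
  (EFin \o u).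
rewrite preT => <- //; last by apply/measurable_EFinP.
congr fine; apply: eq_measure_integral => A mA _.
apply: lebesgue_measure_unique => // _ [[x y]] _ <-.
have E := preT false false (x - c) (y - c); rewrite !subrK in E.
rewrite /= /pushforward E.
rewrite !lebesgue_measure_itv /= !lte_fin ltrD2r.
by case: ifP => // _; rewrite -!EFinB; congr (_%:E); ring.
Qed.

(** The cells centred at the even nodes tile [-dx, 1 - dx] and not [0, 1]; for a
    periodic function this makes no difference, which is the case a = dx. *)
Lemma Rintegral_period u r a : 0 <= r -> measurable_fun setT u ->
  {ae mu, forall x, `|u x| <= r} -> periodic1 u -> 0 <= a <= 1 ->
  \int[mu]_(x in `[- a, 1 - a]) u x = \int[mu]_(x in `[0, 1]) u x.
Proof.
move=> r0 mu_u ur u1 /andP[a0 a1].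
rewrite (@Rintegral_cc_split u (- a) 0 (1 - a)); try lra; last first.
  by apply: ae_bounded_integrable ur => //; lra.
rewrite [RHS](@Rintegral_cc_split u 0 (1 - a) 1); try lra; last first.
  by apply: ae_bounded_integrable ur => //; lra.
rewrite addrC; congr (_ + _).
have := @Rintegral_translate u (- a) 0 1 mu_u.
rewrite (_ : (fun x => u (x + 1)) = u); last exact/funext.
rewrite add0r addrC => -> //.
by apply: ae_bounded_integrable ur => //; lra.
Qed.

Lemma measurable_step (w : int -> R) (d : R) : 0 < d ->
  measurable_fun setT (fun x : R => w (Num.floor (x / d))).
Proof.
move=> d0 _ Y mY; rewrite setTI.
pose cell (n : nat) : set R :=
  if unpickle n is Some j then
    if w j \in Y then `[j%:~R * d, (j + 1)%:~R * d[%classic else set0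
  else set0.
rewrite (_ : _ @^-1` _ = \bigcup_n cell n).
  apply: bigcupT_measurable => n; rewrite /cell.
  by case: unpickle => // j; case: ifP.
apply/seteqP; split => x /=.
  have := floor_itv (x / d); move: (Num.floor _) => j jx xY.
  exists (pickle j); first exact: I.
  rewrite /cell pickleK (mem_set xY) /= in_itv/=.
  by rewrite -ler_pdivlMr// -ltr_pdivrMr.
move=> [n _]; rewrite /cell; case: unpickle => // j.
case: ifP => // /set_mem Yj /=; rewrite in_itv/=.
by rewrite -ler_pdivlMr// -ltr_pdivrMr// => /floor_def ->.
Qed.

End PeriodicIntegrals.

(** * The Lax-Friedrichs scheme on one period *)

Section Parity.
Implicit Types (m i : int) (k p : nat).

Lemma on_gridE k i : on_grid (2 * i + k%:Z) k.
Proof. by rewrite /on_grid; lia. Qed.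

Lemma on_grid_even i : on_grid (2 * i) 0.
Proof. by rewrite -[2 * i]addr0 on_gridE. Qed.

Lemma on_gridP m k : on_grid m k -> exists i, m = 2 * i + k%:Z.
Proof. by rewrite /on_grid => mk; exists ((m - k%:Z) %/ 2)%Z; lia. Qed.

Lemma on_grid_shift m k p : on_grid m (2 * p + k) = on_grid m k.
Proof.
rewrite /on_grid (_ : m + _ = 2 * p%:Z + (m + k%:Z)); last by lia.
by rewrite rpredDl ?dvdz_mulr.
Qed.

Lemma on_grid_period m k p : on_grid (m + (2 * p)%N%:Z) k = on_grid m k.
Proof. by rewrite -(on_grid_shift m k p) /on_grid; congr (_ %| _)%Z; lia. Qed.

Lemma on_grid_pred m k : on_grid m k.+1 -> on_grid (m - 1) k /\ on_grid (m + 1) k.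
Proof. by rewrite /on_grid; split; lia. Qed.

End Parity.

Section Grid.
Context {R : realType}.
Variables (H : R -> R -> R -> R) (c : R) (N K : nat).
Lemma cell_x_on_grid k (x : R) : on_grid (cell_x N k x) k.
Proof. by rewrite /cell_x; case: ifPn => //; rewrite /on_grid; lia. Qed.

Lemma cell_x_shift k p (x : R) : cell_x N (2 * p + k) x = cell_x N k x.
Proof. by rewrite /cell_x on_grid_shift. Qed.

Hypothesis fluxH : flux_conditions H.
Hypothesis N_gt0 : (0 < N)%N.
Local Notation mu := (@lebesgue_measure R).
Local Notation dx := (mesh_dx N : R).
Local Notation dt := (mesh_dt K : R).
Local Notation sol u := (LF H c N K u).

Lemma mesh_dx_gt0 : 0 < dx.
Proof. by rewrite invr_gt0 ltr0n muln_gt0. Qed.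

Lemma mesh_dt_gt0 : (0 < K)%N -> 0 < dt.
Proof. by move=> K_gt0; rewrite invr_gt0 ltr0n muln_gt0. Qed.

Lemma mesh_xD (m n : int) : mesh_x N (m + n) = mesh_x N m + n%:~R * dx.
Proof. by rewrite /mesh_x intrD mulrDl. Qed.

Lemma mesh_x_period m : mesh_x N (m + (2 * N)%N%:Z) = mesh_x N m + 1 :> R.
Proof.
rewrite mesh_xD; congr (_ + _).
by rewrite /mesh_dx -pmulrn divff// pnatr_eq0 muln_eq0 -lt0n.
Qed.

Lemma mesh_t_period k p : (0 < K)%N ->
  mesh_t K (2 * K * p + k) = mesh_t K k + p%:R :> R.
Proof.
move=> K_gt0; rewrite /mesh_t natrD mulrDl addrC; congr (_ + _).
by rewrite natrM mulrAC /mesh_dt divff ?mul1r// pnatr_eq0 muln_eq0 -lt0n.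
Qed.

Lemma flux_time_period x t p q : H x (t + p%:R) q = H x t q.
Proof.
elim: p => [|p IH]; first by rewrite addr0.
by rewrite -addn1 natrD addrA (flux_periodic_t fluxH x q) IH.
Qed.

Lemma cell_xE m k (x : R) : on_grid m k ->
  mesh_x N (m - 1) <= x < mesh_x N (m + 1) -> cell_x N k x = m.
Proof.
move=> mk; have dx0 := mesh_dx_gt0.
rewrite /cell_x; have := floor_itv (x / dx); set j := Num.floor _ => /andP[j1 j2].
rewrite /mesh_x -ler_pdivlMr// -ltr_pdivrMr// => /andP[m1 m2].
have : ((m - 1)%:~R : R) < (j + 1)%:~R by exact: le_lt_trans j2.
have : (j%:~R : R) < (m + 1)%:~R by exact: le_lt_trans m2.
rewrite !ltr_int; move: mk; rewrite /on_grid => mk jm mj.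
by case: ifPn => jk; lia.
Qed.

Lemma cell_x_period k (x : R) :
  cell_x N k (x + 1) = cell_x N k x + (2 * N)%N%:Z.
Proof.
rewrite /cell_x mulrDl mul1r.
have -> : dx^-1 = (2 * N)%N%:Z%:~R by rewrite /mesh_dx invrK -pmulrn.
rewrite floorDrz ?intr_int// intrKfloor.
by rewrite on_grid_period; case: ifP => // _; rewrite addrAC.
Qed.

Lemma cell_t_nat p : cell_t K (p%:R : R) = (2 * K * p)%N.
Proof. by rewrite /cell_t /mesh_dt invrK -natrM natrK mulnC. Qed.

Lemma cell_tD1 (t : R) : 0 <= t -> cell_t K (t + 1) = (2 * K * 1 + cell_t K t)%N.
Proof.
move=> t0; rewrite /cell_t mulrDl mul1r /mesh_dt invrK addrC
  truncnD ?natr_nat ?nnegrE ?mulr_ge0//.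
by rewrite natrK muln1.
Qed.

(** The values at a later time depend on the grid values at time 0 only, and H
    has period one in t: a solution which agrees at time 0 with another one
    at time p follows it from there on.  For p = 0 this is locality. *)
Lemma LF_restart u v p : (0 < K)%N ->
  (forall m, on_grid m 0 -> sol v 0 m = sol u (2 * K * p)%N m) ->
  forall k m, on_grid m k -> sol v k m = sol u (2 * K * p + k)%N m.
Proof.
move=> K_gt0 uv; elim=> [|k IH] m mk; first by rewrite uv// addn0.
have [mk1 mk2] := on_grid_pred mk.
by rewrite addnS [LHS]/= [RHS]/= !IH// mesh_t_period// !flux_time_period.
Qed.

Lemma phi_Delta_natE p u x :
  phi_Delta H N K p%:R c u x = sol u (2 * K * p)%N (cell_x N 0 x).
Proof.
by rewrite /phi_Delta /u_Delta cell_t_nat -mulnA -[X in cell_x _ X]addn0 cell_x_shift.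
Qed.

Lemma phi_DeltaD1 t u x : 0 <= t ->
  phi_Delta H N K (t + 1) c u x =
  sol u (2 * K * 1 + cell_t K t) (cell_x N (cell_t K t) x).
Proof.
by move=> t0; rewrite /phi_Delta /u_Delta cell_tD1// -mulnA cell_x_shift.
Qed.

(** The cells are those of even time levels, so [LF H c N K (grid_step w) 0]
    gives back [w] at even nodes. *)
Definition grid_step (w : int -> R) (x : R) : R := w (cell_x N 0 x).

Lemma grid_step_measurable w : measurable_fun setT (grid_step w).
Proof.
exact: (measurable_step (fun j => w (if on_grid j 0 then j else j + 1))
  mesh_dx_gt0).
Qed.

Lemma grid_step_periodic w :
  (forall m, on_grid m 0 -> w (m + (2 * N)%N%:Z) = w m) ->
  periodic1 (grid_step w).
Proof.
by move=> wN x; rewrite /grid_step cell_x_period wN// cell_x_on_grid.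
Qed.

Lemma LF0_grid_step w m : on_grid m 0 -> sol (grid_step w) 0 m = w m.
Proof.
move=> m0 /=; have dx0 := mesh_dx_gt0.
have cellE x : x \in `[mesh_x N m - dx, mesh_x N m + dx[ -> grid_step w x = w m.
  rewrite in_itv/= => xm; rewrite /grid_step (cell_xE m0)//.
  by rewrite !mesh_xD mulr1z mulN1r mul1r.
have cell_lt : mesh_x N m - dx < mesh_x N m + dx by lra.
rewrite /Rintegral -integral_itv_bndo_bndc; last first.
  apply/measurable_EFinP; apply: measurable_funTS.
  exact: grid_step_measurable.
rewrite (@eq_integral _ _ _ mu _ (cst (w m)%:E)); last first.
  by move=> x /set_mem xm; congr EFin; exact: cellE.
rewrite integral_cst//= lebesgue_measure_itv/= lte_fin cell_lt -EFinB -EFinM/=.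
by field; lra.
Qed.

Section BoundedData.
Variables (r : R) (u : R -> R).
Hypotheses (r_ge0 : 0 <= r) (u_meas : measurable_fun setT u).
Hypotheses (u_per : periodic1 u) (u_bound : {ae mu, forall x, `|u x| <= r}).

Lemma LF0_bound m : `|sol u 0 m| <= r.
Proof.
have dx0 := mesh_dx_gt0.
have dx2 : 0 < 2 * dx by lra.
rewrite /= normrM gtr0_norm ?invr_gt0// ler_pdivrMl//.
have cell_le : mesh_x N m - dx <= mesh_x N m + dx by lra.
apply: le_trans (ae_bounded_Rintegral r_ge0 cell_le u_meas u_bound) _.
by rewrite le_eqVlt; apply/orP; left; apply/eqP; ring.
Qed.

Lemma LF_periodic k m : sol u k (m + (2 * N)%N%:Z) = sol u k m.
Proof.
elim: k m => [|k IH] m /=.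
  congr (_ * _); rewrite mesh_x_period addrAC [X in `[_, X]]addrAC.
  rewrite Rintegral_translate//.
    by apply: eq_Rintegral => x _; rewrite u_per.
  rewrite (_ : (fun x => u (x + 1)) = u); last exact/funext.
  by apply: ae_bounded_integrable u_bound => //; have := mesh_dx_gt0; lra.
rewrite [m + _ + 1]addrAC [m + _ - 1]addrAC !IH.
by rewrite !mesh_x_period !(flux_periodic_x fluxH).
Qed.

(** The cells of the even nodes of a period tile an interval of length one. *)
Lemma LF0_period_sum : period_sum N (fun i => sol u 0 (2 * i)) =
  (2 * dx)^-1 * \int[mu]_(y in `[0, 1]) u y.
Proof.
have dx0 := mesh_dx_gt0.
have cells n : \sum_(i < n) \int[mu]_(y in
      `[mesh_x N (2 * i%:Z) - dx, mesh_x N (2 * i%:Z) + dx]) u y =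
    \int[mu]_(y in `[- dx, mesh_x N (2 * n%:Z) - dx]) u y.
  elim: n => [|n IH].
    rewrite big_ord0 mulr0 /mesh_x mul0r add0r set_itv1.
    by rewrite Rintegral_set1.
  rewrite big_ord_recr /= IH.
  have xn : mesh_x N (2 * n%:Z) + dx = mesh_x N (2 * n.+1%:Z) - dx.
    by rewrite (_ : 2 * n.+1%:Z = 2 * n%:Z + 2)%Z ?mesh_xD; [ring|lia].
  have xn0 : 0 <= mesh_x N (2 * n%:Z) :> R.
    by rewrite /mesh_x mulr_ge0 ?ler0z// ltW.
  rewrite -xn -Rintegral_cc_split//; try lra.
  by apply: ae_bounded_integrable u_bound => //; lra.
rewrite /period_sum /= -mulr_sumr.
rewrite cells; congr (_ * _).
have -> : mesh_x N (2 * N%:Z) = 1 :> R.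
  have := mesh_x_period 0.
  by rewrite add0r [mesh_x N 0 in RHS]/mesh_x mul0r add0r => <-; congr mesh_x; lia.
apply: (Rintegral_period r_ge0 u_meas u_bound u_per).
by rewrite ltW//= invf_le1 ?ler1n ?ltr0n; lia.
Qed.

End BoundedData.

Lemma grid_step_data r w : 0 <= r ->
  (forall m, on_grid m 0 -> w (m + (2 * N)%N%:Z) = w m) ->
  (Linf_norm (grid_step w) <= r%:E)%E ->
  period_sum N (fun i => w (2 * i)) = 0 ->
  Linf_zero_mean r (grid_step w).
Proof.
move=> r0 wN wr w_mass; split => //.
- exact: grid_step_measurable.
- exact: grid_step_periodic.
- have dx2 : (2 * dx)^-1 != 0.
    by rewrite invr_neq0// mulf_neq0 ?gt_eqF ?mesh_dx_gt0.
  have /Linf_normP wb := wr.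
  have := LF0_period_sum r0 (grid_step_measurable w) (grid_step_periodic wN) wb.
  rewrite /period_sum; under eq_bigr do rewrite LF0_grid_step ?on_grid_even//.
  rewrite (w_mass : \sum_(i < N) _ = 0) => /esym/eqP.
  by rewrite mulf_eq0 (negPf dx2) => /eqP.
Qed.

Section Data.
Variables (r : R) (u : R -> R).
Hypotheses (r_ge0 : 0 <= r) (uP : Linf_zero_mean r u).

Lemma LF_data_bound m : `|sol u 0 m| <= r.
Proof. by case: uP => ? ? /Linf_normP ? _; exact: LF0_bound. Qed.

Lemma LF_data_periodic k m : sol u k (m + (2 * N)%N%:Z) = sol u k m.
Proof. by case: uP => ? ? /Linf_normP ? _; exact: (@LF_periodic r). Qed.

Lemma LF_row_periodic k : grid_periodic N (fun i => sol u k (2 * i + k%:Z)).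
Proof. by move=> i; rewrite -[RHS]LF_data_periodic; congr (LF _ _ _ _ _ _ _); lia. Qed.

Lemma LF0_mass : period_sum N (fun i => sol u 0 (2 * i + 0%:Z)) = 0.
Proof.
case: uP => ? ? /Linf_normP ? u0; rewrite /period_sum; under eq_bigr do rewrite addr0.
rewrite [LHS](@LF0_period_sum r)//; apply/eqP; rewrite mulf_eq0.
by apply/orP; right; apply/eqP.
Qed.

(** The scheme is conservative: the update adds a flux difference, which
    telescopes over a period. *)
Lemma LF_mass k : period_sum N (fun i => sol u k (2 * i + k%:Z)) = 0.
Proof.
elim: k => [|k IH]; first exact: LF0_mass.
pose b i := sol u k (2 * i + k%:Z) / 2 - dt / (2 * dx) *
  H (mesh_x N (2 * i + k%:Z)) (mesh_t K k) (c + sol u k (2 * i + k%:Z)).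
have bN : grid_periodic N b.
  move=> i; rewrite /b (_ : 2 * (i + N%:Z) + k%:Z = 2 * i + k%:Z + (2 * N)%N%:Z).
    by rewrite LF_data_periodic mesh_x_period (flux_periodic_x fluxH).
  by lia.
have stepE (i : int) : sol u k.+1 (2 * i + k.+1%:Z) =
    sol u k (2 * i + k%:Z) + (b (i + 1) - b i).
  rewrite /b /= (_ : 2 * i + k.+1%:Z - 1 = 2 * i + k%:Z); last by lia.
  rewrite (_ : 2 * i + k.+1%:Z + 1 = 2 * (i + 1) + k%:Z); last by lia.
  by field; have := mesh_dx_gt0; lra.
rewrite /period_sum; under eq_bigr do rewrite stepE.
rewrite big_split sumrB /=; have := period_sum_shift1 bN; rewrite /period_sum => ->.
by rewrite subrr addr0; exact: IH.
Qed.

Lemma LF_even_mass p : period_sum N (fun i => sol u (2 * p) (2 * i)) = 0.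
Proof.
rewrite -(LF_mass (2 * p)).
rewrite -(period_sum_shift (- p%:Z) (LF_row_periodic (2 * p))).
by apply: eq_bigr => i _; congr (LF _ _ _ _ _ _ _); lia.
Qed.

End Data.
End Grid.

(** * Convergence of sequences *)

Section Limits.
Context {R : realType}.

Lemma cvg_geometric_increments (w : R^nat) (a q : R) : 0 <= q < 1 ->
  (forall n, `|w n.+1 - w n| <= a * q ^+ n) -> cvgn w.
Proof.
move=> /andP[q0 q1] wq.
have a0 : 0 <= a by have := wq 0%N; rewrite expr0 mulr1; apply: le_trans.
have sc : cvgn (series (fun n => w n.+1 - w n)).
  apply: normed_cvg; apply: (@series_le_cvg _ _ (geometric a q)) => //.
  - by move=> n; exact: normr_ge0.
  - by move=> n; exact: geometric_ge0.
  - by apply: is_cvg_geometric_series; rewrite ger0_norm.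
have -> : w = (fun n => w 0%N + series (fun n => w n.+1 - w n) n).
  by apply/funext => n; rewrite seriesEnat /= telescope_sumr// addrC subrK.
by apply: is_cvgD => //; exact: is_cvg_cst.
Qed.

Lemma cvg_period_sum N (f : nat -> int -> R) (g : int -> R) :
  (forall i, f n i @[n --> \oo] --> g i) ->
  period_sum N (f n) @[n --> \oo] --> period_sum N g.
Proof.
move=> fg; rewrite /period_sum; elim: N => [|N IH].
  by under eq_fun do rewrite big_ord0; rewrite big_ord0; exact: cvg_cst.
under eq_fun do rewrite big_ord_recr; rewrite big_ord_recr /=.
exact: cvgD.
Qed.

End Limits.

(** * The period map and its fixed point *)

Section Contraction.
Context {R : realType}.
Variables (H : R -> R -> R -> R) (c : R) (N K : nat) (r lambda1 : R).
Hypothesis fluxH : flux_conditions H.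
Hypotheses (N_gt0 : (0 < N)%N) (NK : (N <= K)%N).
Hypotheses (r_gt0 : 0 < r) (lambda1_gt0 : 0 < lambda1).
Hypothesis lambda_lt : mesh_lambda N K < lambda1.
Hypothesis stable : forall u, Linf_zero_mean r u ->
  CFL H lambda1 c N K u /\ (Linf_norm (phi_Delta H N K 1 c u) <= r%:E)%E.
Local Notation mu := (@lebesgue_measure R).
Local Notation dx := (mesh_dx N : R).
Local Notation dt := (mesh_dt K : R).
Local Notation lambda := (mesh_lambda N K : R).
Local Notation sol u := (LF H c N K u).
Local Notation phi1 := (phi_Delta H N K 1 c).

Let K_gt0 : (0 < K)%N. Proof. exact: leq_trans NK. Qed.
Let r_ge0 : 0 <= r. Proof. exact: ltW. Qed.

(** The coefficient of [transport] for the difference of two solutions. *)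
Definition weight u v (k : nat) (i : int) : R :=
  (1 + lambda * flux_slope H (mesh_x N (2 * i + k%:Z)) (mesh_t K k)
    (c + sol u k (2 * i + k%:Z)) (c + sol v k (2 * i + k%:Z))) / 2.

Definition weight_min : R := (1 - lambda / lambda1) / 2.

Lemma mesh_lambda_gt0 : 0 < lambda.
Proof. by rewrite divr_gt0 ?mesh_dx_gt0 ?mesh_dt_gt0. Qed.

Lemma weight_min_gt0 : 0 < weight_min.
Proof. by rewrite divr_gt0// subr_gt0 ltr_pdivrMr// mul1r. Qed.

Lemma weight_min_lt1 : weight_min < 1.
Proof.
have : 0 < lambda / lambda1 by rewrite divr_gt0 ?mesh_lambda_gt0.
by rewrite /weight_min; lra.
Qed.

(** One time period has 2K steps, each with weights at least [weight_min]. *)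
Definition contraction_rate : R := 1 - weight_min ^+ (2 * K).

Lemma contraction_rate_gt0 : 0 < contraction_rate.
Proof.
rewrite subr_gt0 exprn_ilt1 ?weight_min_lt1//; first by lia.
exact/ltW/weight_min_gt0.
Qed.

Lemma contraction_rate_lt1 : contraction_rate < 1.
Proof. by rewrite gtrBl exprn_gt0 ?weight_min_gt0. Qed.

Section TwoData.
Variables (u v : R -> R).
Hypotheses (uP : Linf_zero_mean r u) (vP : Linf_zero_mean r v).

Lemma weight_bounds k i : weight_min <= weight u v k i <= 1 - weight_min.
Proof.
have [[_ cflu] _] := stable uP; have [[_ cflv] _] := stable vP.
have := flux_slope_bound fluxH (cflu _ _ (on_gridE k i)) (cflv _ _ (on_gridE k i)).
rewrite /weight /weight_min; set s := flux_slope _ _ _ _ _ => sB.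
have : `|lambda * s| <= lambda / lambda1.
  by rewrite normrM gtr0_norm ?mesh_lambda_gt0// ler_pM2l ?mesh_lambda_gt0.
by rewrite ler_norml => /andP[h1 h2]; lra.
Qed.

Lemma weight_periodic k : grid_periodic N (weight u v k).
Proof.
move=> i; rewrite /weight /flux_slope.
rewrite (_ : 2 * (i + N%:Z) + k%:Z = 2 * i + k%:Z + (2 * N)%N%:Z); last by lia.
rewrite !(LF_data_periodic c K fluxH N_gt0 r_ge0 uP)//
  !(LF_data_periodic c K fluxH N_gt0 r_ge0 vP)//.
by rewrite mesh_x_period// !(flux_periodic_x fluxH).
Qed.

(** The difference of the two updates is linear in the differences, with the
    slopes of the chords of H as coefficients; [transport] collects them. *)
Lemma LF_diff_evolve k i :
  sol u k (2 * i + k%:Z) - sol v k (2 * i + k%:Z) =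
  evolve (weight u v) k (fun j => sol u 0 (2 * j + 0%:Z) - sol v 0 (2 * j + 0%:Z)) i.
Proof.
elim: k i => // k IH i; rewrite [RHS]/= /transport -!IH.
rewrite [sol u k.+1 _]/= [sol v k.+1 _]/=.
rewrite (_ : 2 * i + k.+1%:Z - 1 = 2 * i + k%:Z); last by lia.
rewrite (_ : 2 * i + k.+1%:Z + 1 = 2 * (i + 1) + k%:Z); last by lia.
rewrite /weight; set m := 2 * i + k%:Z; set n := 2 * (i + 1) + k%:Z.
have := flux_slopeE H (mesh_x N m) (mesh_t K k) (c + sol u k m) (c + sol v k m).
have := flux_slopeE H (mesh_x N n) (mesh_t K k) (c + sol u k n) (c + sol v k n).
set sn := flux_slope _ _ _ _ _; set sm := flux_slope _ _ _ _ _.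
have -> : dt / (2 * dx) = lambda / 2.
  by rewrite /mesh_lambda; field; have := mesh_dx_gt0 (R := R) N_gt0; lra.
set Hun := H _ _ (c + sol u k n); set Hum := H _ _ (c + sol u k m).
move=> /(canRL (subrK _)) -> /(canRL (subrK _)) ->.
by field.
Qed.

(** The period of 2K steps moves the coordinate i by K; the shift leaves sums
    over a space period unchanged. *)
Lemma LF_contraction :
  period_sum N (fun i => `|sol u (2 * K)%N (2 * i) - sol v (2 * K)%N (2 * i)|)
  <= contraction_rate * period_sum N (fun i => `|sol u 0 (2 * i) - sol v 0 (2 * i)|).
Proof.
pose d0 (j : int) := sol u 0 (2 * j + 0%:Z) - sol v 0 (2 * j + 0%:Z).
have d0N : grid_periodic N d0.
  have uN := LF_row_periodic c K fluxH N_gt0 r_ge0 uP 0.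
  have vN := LF_row_periodic c K fluxH N_gt0 r_ge0 vP 0.
  by move=> j; exact: (f_equal2 (fun x y : R => x - y) (uN j) (vN j)).
have d0_mass : period_sum N d0 = 0.
  rewrite /period_sum sumrB.
  have := LF0_mass H c K N_gt0 r_ge0 uP; have := LF0_mass H c K N_gt0 r_ge0 vP.
  by rewrite /period_sum => -> ->; rewrite subrr.
have -> : period_sum N (fun i => `|sol u 0 (2 * i) - sol v 0 (2 * i)|) =
          period_sum N (fun i => `|d0 i|).
  by apply: eq_bigr => i _; rewrite /d0 addr0.
have := @evolve_contraction R N weight_min (weight u v) (ltW weight_min_gt0)
  weight_periodic weight_bounds (2 * K) d0 _ d0N d0_mass.
move=> /(_ ltac:(lia)); apply: le_trans.
rewrite -(period_sum_shift K%:Z); last first.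
  move=> i; congr (`|_ - _|).
  - rewrite -[RHS](LF_data_periodic c K fluxH N_gt0 r_ge0 uP).
    by congr (LF _ _ _ _ _ _ _); lia.
  - rewrite -[RHS](LF_data_periodic c K fluxH N_gt0 r_ge0 vP).
    by congr (LF _ _ _ _ _ _ _); lia.
apply: ler_sum => i _; rewrite -LF_diff_evolve.
by rewrite (_ : 2 * (i%:Z + K%:Z) = 2 * i%:Z + (2 * K)%N%:Z)//; lia.
Qed.

End TwoData.

Let phi1E u : phi1 u = grid_step N (sol u (2 * K)%N).
Proof.
apply/funext => x.
by have := phi_Delta_natE H c N K 1 u x; rewrite muln1.
Qed.

Lemma phi1_data u : Linf_zero_mean r u -> Linf_zero_mean r (phi1 u).
Proof.
move=> uP; have [_] := stable uP; rewrite phi1E => ur.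
apply: grid_step_data => //.
  by move=> m _; exact: (LF_data_periodic c K fluxH N_gt0 r_ge0 uP).
exact: (LF_even_mass c K fluxH N_gt0 r_ge0 uP).
Qed.

Lemma LF_phi1 u k m : on_grid m k -> sol (phi1 u) k m = sol u (2 * K * 1 + k)%N m.
Proof.
apply: (LF_restart fluxH K_gt0) => {}m m0.
by rewrite phi1E LF0_grid_step// muln1.
Qed.

Lemma iter_phi1_data u n :
  Linf_zero_mean r u -> Linf_zero_mean r (iter n phi1 u).
Proof. by move=> uP; elim: n => //= n; exact: phi1_data. Qed.

(** Iterates of the period map are samples of a single trajectory. *)
Lemma LF_iter_phi1 u n k m : on_grid m k ->
  sol (iter n phi1 u) k m = sol u (2 * K * n + k)%N m.
Proof.
elim: n k => [|n IH] k mk; first by rewrite muln0.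
rewrite iterS LF_phi1// IH; last by rewrite -mulnA on_grid_shift.
by congr (LF _ _ _ _ _ _ _); lia.
Qed.

(** Solutions depend on their data through the cell averages alone, so the
    distance compares those and not the data. *)
Definition grid_dist u v : R :=
  period_sum N (fun i => `|sol u 0 (2 * i) - sol v 0 (2 * i)|).

Lemma grid_dist_ge0 u v : 0 <= grid_dist u v.
Proof. by apply: sumr_ge0. Qed.

Lemma grid_dist_phi1 u v : Linf_zero_mean r u -> Linf_zero_mean r v ->
  grid_dist (phi1 u) (phi1 v) <= contraction_rate * grid_dist u v.
Proof.
move=> uP vP; apply: le_trans (LF_contraction uP vP).
rewrite /grid_dist /period_sum ler_sum// => i _.
by rewrite !LF_phi1 ?on_grid_even// addn0 muln1.
Qed.

Lemma grid_dist_iter u v n : Linf_zero_mean r u -> Linf_zero_mean r v ->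
  grid_dist (iter n phi1 u) (iter n phi1 v) <= contraction_rate ^+ n * grid_dist u v.
Proof.
move=> uP vP; elim: n => [|n IH]; first by rewrite expr0 mul1r.
rewrite !iterS exprS -mulrA.
apply: le_trans (grid_dist_phi1 (iter_phi1_data n uP) (iter_phi1_data n vP)) _.
by rewrite ler_pM2l ?contraction_rate_gt0.
Qed.

Lemma grid_dist_bound u v : Linf_zero_mean r u -> Linf_zero_mean r v ->
  grid_dist u v <= N%:R * (2 * r).
Proof.
move=> uP vP; rewrite mulr_natl -[in leRHS](card_ord N) -sumr_const.
apply: ler_sum => i _; apply: le_trans (ler_normB _ _) _.
have := LF_data_bound H c K N_gt0 r_ge0 uP (2 * i%:Z).
by have := LF_data_bound H c K N_gt0 r_ge0 vP (2 * i%:Z); lra.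
Qed.

Lemma le_grid_dist u v m : Linf_zero_mean r u -> Linf_zero_mean r v ->
  on_grid m 0 -> `|sol u 0 m - sol v 0 m| <= grid_dist u v.
Proof.
move=> uP vP /on_gridP[i ->]; rewrite addr0.
apply: (@le_period_sum _ N (fun i => `|sol u 0 (2 * i) - sol v 0 (2 * i)|)) => //.
move=> j; rewrite (_ : 2 * (j + N%:Z) = 2 * j + (2 * N)%N%:Z); last by lia.
rewrite (LF_data_periodic c K fluxH N_gt0 r_ge0 uP).
by rewrite (LF_data_periodic c K fluxH N_gt0 r_ge0 vP).
Qed.

Lemma LF_decay u v n m : Linf_zero_mean r u -> Linf_zero_mean r v ->
  on_grid m 0 ->
  `|sol u (2 * K * n)%N m - sol v (2 * K * n)%N m|
    <= N%:R * (2 * r) * contraction_rate ^+ n.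
Proof.
move=> uP vP m0; rewrite -[(2 * K * n)%N]addn0 -!LF_iter_phi1//.
apply: le_trans (le_grid_dist (iter_phi1_data n uP) (iter_phi1_data n vP) m0) _.
apply: le_trans (grid_dist_iter n uP vP) _.
rewrite mulrC ler_wpM2r ?exprn_ge0 ?grid_dist_bound//.
exact/ltW/contraction_rate_gt0.
Qed.

Lemma LF_fixed_unique u v : Linf_zero_mean r u -> Linf_zero_mean r v ->
  (forall m, on_grid m 0 -> sol u (2 * K)%N m = sol u 0 m) ->
  (forall m, on_grid m 0 -> sol v (2 * K)%N m = sol v 0 m) ->
  forall m, on_grid m 0 -> sol u 0 m = sol v 0 m.
Proof.
move=> uP vP ufix vfix m m0.
have d_contr : grid_dist u v <= contraction_rate * grid_dist u v.
  have := LF_contraction uP vP; rewrite /grid_dist /period_sum.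
  by under eq_bigr do rewrite ufix ?on_grid_even// vfix ?on_grid_even//.
have d0 : grid_dist u v <= 0.
  rewrite leNgt; apply/negP => d_gt0; move: d_contr.
  by rewrite leNgt gtr_pMl ?contraction_rate_lt1.
apply/eqP; rewrite -subr_eq0 -normr_le0.
exact: le_trans (le_grid_dist uP vP m0) d0.
Qed.

Lemma zero_data : Linf_zero_mean r (cst 0).
Proof.
split.
- exact: measurable_cst.
- by [].
- by apply: Linf_norm_le => x; rewrite normr0.
- by rewrite Rintegral_cst// mul0r.
Qed.

(** The limit of the iterates of 0 inherits the bound, the mean and the
    periodicity, and the contraction makes the period map continuous, so the
    limit of the iterates is fixed. *)
Lemma exists_fixed : exists w : int -> R,
  Linf_zero_mean r (grid_step N w) /\
  forall m, on_grid m 0 -> sol (grid_step N w) (2 * K)%N m = w m.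
Proof.
pose U n := iter n phi1 (cst 0 : R -> R).
have UP n : Linf_zero_mean r (U n) := iter_phi1_data n zero_data.
pose W n m := sol (U n) 0 m.
pose w m := limn (W ^~ m).
have Ww m : on_grid m 0 -> W n m @[n --> \oo] --> w m.
  move=> m0; apply: (@cvg_geometric_increments _ _ (N%:R * (2 * r)) contraction_rate).
    by rewrite contraction_rate_lt1 ltW// contraction_rate_gt0.
  move=> n; rewrite /W /U iterSr !LF_iter_phi1// addn0.
  exact: (LF_decay n (phi1_data zero_data) zero_data m0).
have wN m : on_grid m 0 -> w (m + (2 * N)%N%:Z) = w m.
  move=> _; rewrite /w; congr (limn _); apply/funext => n.
  exact: (LF_data_periodic c K fluxH N_gt0 r_ge0 (UP n)).
have wr m : on_grid m 0 -> `|w m| <= r.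
  move=> m0; have /cvg_norm Wm := Ww m m0.
  rewrite -(cvg_lim _ Wm)//; apply: limr_le; first exact: cvgP Wm.
  by apply: nearW => n /=; exact: (LF_data_bound H c K N_gt0 r_ge0 (UP n)).
have w_mass : period_sum N (fun i => w (2 * i)) = 0.
  apply: (@cvg_unique _ (@norm_hausdorff _ R) _ _ _ _
    (@cvg_period_sum _ N (fun n i => W n (2 * i)) _ _)) => [i|].
    exact/Ww/on_grid_even.
  apply: cvg_near_cst; apply: nearW => n.
  exact: (LF_even_mass c K fluxH N_gt0 r_ge0 (UP n) 0).
have wP : Linf_zero_mean r (grid_step N w).
  apply: grid_step_data => //; apply: Linf_norm_le => x.
  exact/wr/cell_x_on_grid.
exists w; split=> // m m0.
have dist0 : grid_dist (U n) (grid_step N w) @[n --> \oo] --> (0 : R).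
  have -> : (0 : R) = period_sum N (fun _ => 0) by rewrite /period_sum big1_eq.
  apply: (@cvg_period_sum _ N
    (fun n i => `|sol (U n) 0 (2 * i) - sol (grid_step N w) 0 (2 * i)|)) => i.
  rewrite LF0_grid_step ?on_grid_even//.
  rewrite -[X in _ --> X](normr0 R) -[X in `|X|](subrr (w (2 * i))).
  by apply: cvg_norm; apply: cvgB; [exact/Ww/on_grid_even|exact: cvg_cst].
have W1 : W n.+1 m @[n --> \oo] --> sol (grid_step N w) (2 * K)%N m.
  apply/cvgrPdist_le => e e0.
  have /cvgrPdist_le/(_ _ e0) := dist0; apply: filterS => n /=.
  rewrite sub0r normrN ger0_norm ?grid_dist_ge0// => de.
  rewrite distrC -[(2 * K)%N]muln1 -[(2 * K * 1)%N]addn0 -LF_phi1//.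
  apply: le_trans (le_grid_dist (UP n.+1) (phi1_data wP) m0) _.
  apply: le_trans (grid_dist_phi1 (UP n) wP) (le_trans _ de).
  by rewrite ler_piMl ?grid_dist_ge0// ltW// contraction_rate_lt1.
apply: (@cvg_unique _ (@norm_hausdorff _ R) _ _ _ _ W1).
by have := Ww m m0; rewrite -cvg_shiftS.
Qed.

End Contraction.

(** * Periodic difference solutions *)

Theorem theorem3p5 (R : realType) (H : R -> R -> R -> R)
    (r c0 c1 beta1 lambda0 lambda1 delta : R)
    (flux_H : flux_conditions H)
    (r_gt0 : 0 < r) (c0_le_c1 : c0 <= c1)
    (beta1_gt0 : 0 < beta1)
    (beta1_bound : forall (c M : R) (u0 : R -> R) (u : R -> R -> R),
      c0 <= c <= c1 -> Linf_zero_mean M u0 -> entropy_solution H c u0 u ->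
      (Linf_norm (u ^~ 1%R) <= beta1%:E)%E)
    (lambda0_gt0 : 0 < lambda0) (lambda0_lt1 : lambda0 < lambda1)
    (delta_gt0 : 0 < delta)
    (stability : forall (N K : nat) (c : R) (u0 : R -> R),
      mesh_ok lambda0 lambda1 delta N K -> c0 <= c <= c1 ->
      Linf_zero_mean r u0 ->
      CFL H lambda1 c N K u0 /\
      (Linf_norm (phi_Delta H N K 1 c u0) <= (beta1 + 1)%:E)%E)
    (r_ge : beta1 + 1 <= r)
    (N K : nat) (mesh_NK : mesh_ok lambda0 lambda1 delta N K) :
  forall c : R, c0 <= c <= c1 ->
  exists ubar : R -> R,
    [/\ Linf_zero_mean r ubar,
        {ae @lebesgue_measure R, forall x, phi_Delta H N K 1 c ubar x = ubar x},
        (forall t : R, 0 <= t ->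
           phi_Delta H N K (t + 1) c ubar = phi_Delta H N K t c ubar),
        (forall v0 : R -> R, Linf_zero_mean r v0 ->
           (forall t : R, 0 <= t ->
              phi_Delta H N K (t + 1) c v0 = phi_Delta H N K t c v0) ->
           forall t : R, 0 <= t ->
             phi_Delta H N K t c v0 = phi_Delta H N K t c ubar)
      & exists rho a : R, [/\ 0 < rho, rho < 1, 0 < a &
          forall u0 : R -> R, Linf_zero_mean r u0 -> forall t : nat,
            (Linf_norm (fun x => (phi_Delta H N K t%:R c u0 x
                                  - phi_Delta H N K t%:R c ubar x)%R)
              <= (a * rho ^+ t)%:E)%E]].
Proof.
move=> c cI; case: (mesh_NK) => N_gt0 NK _ lambda_lt _.
have K_gt0 : (0 < K)%N := leq_trans N_gt0 NK.
have lambda1_gt0 : 0 < lambda1 := lt_trans lambda0_gt0 lambda0_lt1.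
have stable u : Linf_zero_mean r u -> CFL H lambda1 c N K u /\
    (Linf_norm (phi_Delta H N K 1 c u) <= r%:E)%E.
  move=> /(stability _ _ _ _ mesh_NK cI)[cfl ub]; split=> //.
  by apply: le_trans ub _; rewrite lee_fin.
have [w [wP wfix]] := exists_fixed flux_H N_gt0 NK r_gt0 lambda1_gt0 lambda_lt stable.
set ubar := grid_step N w in wP wfix.
have ubar_fix m : on_grid m 0 -> LF H c N K ubar (2 * K)%N m = LF H c N K ubar 0 m.
  by move=> m0; rewrite wfix// LF0_grid_step.
exists ubar; split=> //.
- apply: aeW => x; have := phi_Delta_natE H c N K 1 ubar x.
  by rewrite muln1 => ->; rewrite wfix ?cell_x_on_grid.
- move=> t t0; apply/funext => x; rewrite phi_DeltaD1//.
  rewrite -(@LF_restart _ _ _ _ _ flux_H ubar ubar)// ?cell_x_on_grid//.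
  by move=> m m0; rewrite muln1 ubar_fix.
- move=> v0 v0P v0per t t0; apply/funext => x.
  have v0_fix m : on_grid m 0 -> LF H c N K v0 (2 * K)%N m = LF H c N K v0 0 m.
    move=> m0; have dx0 := mesh_dx_gt0 (R := R) N_gt0.
    have cell_m : cell_x N 0 (mesh_x N m : R) = m.
      by apply: cell_xE => //; rewrite !mesh_xD mulr1z mulN1r mul1r; lra.
    have := congr1 (fun f => f (mesh_x N m)) (v0per 0 (lexx 0)).
    rewrite add0r (phi_Delta_natE H c N K 1) (phi_Delta_natE H c N K 0).
    by rewrite cell_m muln1 muln0.
  rewrite /phi_Delta /u_Delta (@LF_restart _ _ _ _ _ flux_H ubar v0 0)//.
  + by rewrite muln0.
  + move=> m m0; rewrite muln0.
    exact: (LF_fixed_unique flux_H N_gt0 NK r_gt0 lambda1_gt0 lambda_lt stable).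
  + exact: cell_x_on_grid.
- exists (contraction_rate N K lambda1), (N%:R * (2 * r)); split.
  + exact: contraction_rate_gt0.
  + exact: contraction_rate_lt1.
  + by rewrite mulr_gt0 ?ltr0n// mulr_gt0.
  + move=> u0 u0P n; apply: Linf_norm_le => x; rewrite !phi_Delta_natE.
    apply: (LF_decay flux_H N_gt0 NK r_gt0 lambda1_gt0 lambda_lt stable) => //.
    exact: cell_x_on_grid.
Qed.
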